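(* For every $n\ge0$, the symmetric function $(2n)!\,A_n$ is $h$-integral and $h$-positive, i.e. it is a linear combination of the complete homogeneous symmetric functions $h_\lambda$, $\lambda\vdash n$, with nonnegative integer coefficients.
   Context: $A_n=\frac{1}{(2n)!}\sum_{\lambda\vdash n}|\phi(\lambda)|\,p_\lambda$, where for $\lambda=\langle 1^{m_1},\dots,n^{m_n}\rangle\vdash n$ ($m_k$ parts equal to $k$), $\phi(\lambda)=(2n)!\prod_{k=1}^n\frac{1}{m_k!}\left(\frac{4^k(4^k-1)B_{2k}}{(2k)(2k)!}\right)^{m_k}$ with $B_{2k}$ Bernoulli numbers, and $p_\lambda$ are power-sum symmetric functions. *)

(* Defs.v *)
From HB Require Import structures.
From mathcomp Require Import all_boot all_order all_algebra.
From mathcomp Require Export mpoly.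

Set Implicit Arguments.
Unset Strict Implicit.
Unset Printing Implicit Defensive.

Import Order.TTheory GRing.Theory Num.Theory.

Local Open Scope ring_scope.

(* Bernoulli numbers, by the recurrence equivalent to t / (e^t - 1) =
   \sum_m B_m t^m / m! (so B_1 = -1/2); see bernoulli_rec below. *)
Fixpoint bernoulli_seq (n : nat) : seq rat :=
  if n is m.+1 then
    let s := bernoulli_seq m in
    rcons s ((m == 0)%N%:R
             - m.+1%:R^-1 * \sum_(j < m) 'C(m.+1, j)%:R * s`_j)
  else [::].

Definition bernoulli (m : nat) : rat := (bernoulli_seq m.+1)`_m.

Lemma size_bernoulli_seq n : size (bernoulli_seq n) = n.
Proof. by elim: n => //= n IHn; rewrite size_rcons IHn. Qed.

Lemma nth_bernoulli_seq n m : (m < n)%N -> (bernoulli_seq n)`_m = bernoulli m.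
Proof.
elim: n => // n IHn; rewrite ltnS leq_eqVlt => /predU1P[-> //|lt_mn].
by rewrite /= nth_rcons size_bernoulli_seq lt_mn IHn.
Qed.

Lemma bernoulli_rec m :
  \sum_(j < m.+1) 'C(m.+1, j)%:R * bernoulli j = (m == 0)%N%:R.
Proof.
rewrite big_ord_recr /= {2}/bernoulli /= nth_rcons size_bernoulli_seq ltnn eqxx.
under [X in _ - _ * X]eq_bigr => j _ do rewrite nth_bernoulli_seq //.
rewrite binSn mulrBr mulrA divff ?pnatr_eq0 // mul1r addrC subrK.
by case: m => [|m]; rewrite ?mulr1 ?mulr0.
Qed.

(* A partition <1^{m_1}, ..., n^{m_n}> of n is encoded by its multiplicities:
   l k is the number m_{k+1} of parts equal to k.+1, for k : 'I_n. *)
Definition partitions (n : nat) : {set {ffun 'I_n -> 'I_n.+1}} :=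
  [set l : {ffun 'I_n -> 'I_n.+1} | (\sum_(k < n) k.+1 * l k == n)%N].

Definition phi (n : nat) (l : {ffun 'I_n -> 'I_n.+1}) : rat :=
  (2 * n)`!%:R *
  \prod_(k < n)
    ((l k)`!%:R^-1 *
     (4 ^+ k.+1 * (4 ^+ k.+1 - 1) * bernoulli (2 * k.+1)
      / ((2 * k.+1)%:R * (2 * k.+1)`!%:R)) ^+ l k).

(* A symmetric function with rational coefficients is represented by the family
   of its restrictions to r variables x_0, ..., x_(r-1), for all r. *)
Definition symfun : Type := forall r : nat, {mpoly rat[r]}.

Definition powersum (k : nat) : symfun := fun r => \sum_(i < r) 'X_i ^+ k.

Definition complete (k : nat) : symfun :=
  fun r => \sum_(m : 'X_{1..r < k.+1} | mdeg m == k) 'X_[m].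

Definition p_ (n : nat) (l : {ffun 'I_n -> 'I_n.+1}) : symfun :=
  fun r => \prod_(k < n) powersum k.+1 r ^+ l k.

Definition h_ (n : nat) (l : {ffun 'I_n -> 'I_n.+1}) : symfun :=
  fun r => \prod_(k < n) complete k.+1 r ^+ l k.

Definition A_ (n : nat) : symfun :=
  fun r => (2 * n)`!%:R^-1 *: \sum_(l in partitions n) `|phi l| *: p_ l r.

(* Main.v *)
Require Import Defs.
From HB Require Import structures.
From mathcomp Require Import all_boot all_order all_algebra all_field.
From mathcomp Require Import perm ring zify.

Set Implicit Arguments.
Unset Strict Implicit.
Unset Printing Implicit Defensive.

Import Order.TTheory GRing.Theory Num.Theory.

Local Open Scope ring_scope.

(** Let [y_1, y_2, ...] be the reciprocals of the roots of [cos (sqrt x)], so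
    that [e_k(y) = 1 / (2k)!] and [p_k(y) / k], the coefficient of [x^k] in
    [log sec (sqrt x)], is [4^k (4^k - 1) |B_2k| / ((2k) (2k)!)].  The Cauchy
    identity
    [exp (\sum_k p_k(x) p_k(y) t^k / k) = \prod_j H_x(y_j t)
      = \sum_l m_l(y) h_l(x) t^|l|]
    then shows that the coefficient of [h_l] in [(2n)! A_n] is [(2n)! m_l(y)].

    Only [y_1, ..., y_n] with the right [e_1, ..., e_n] matter in degree [n], so
    these can be taken to be the roots of a polynomial over [algC].  Integrality
    follows from writing [m_l] as an integral polynomial in the [e_k]: the
    products [(2n)! / \prod (2 k_i)!] are integers.  For positivity, [cos] is
    approximated by [((1 + i z / N)^N + (1 - i z / N)^N) / 2], all of whose
    roots are real since [|1 + w| = |1 - w|] forces [w] to be imaginary; [m_l]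
    is nonnegative at the corresponding point, where its value is a polynomial
    in [1 / N] whose constant term is [m_l(y)].  *)

(** * Logarithmic derivatives of truncated power series *)

Section TruncatedSeries.
Variable R : comNzRingType.
Implicit Types (p q A G : {poly R}) (N : nat).

Definition eqmX N p q := forall i, (i < N)%N -> p`_i = q`_i.

Lemma eqmX_refl N p : eqmX N p p. Proof. by []. Qed.

Lemma eqmX_sym N p q : eqmX N p q -> eqmX N q p.
Proof. by move=> pq i /pq. Qed.

Lemma eqmX_trans N q p r : eqmX N p q -> eqmX N q r -> eqmX N p r.
Proof. by move=> pq qr i iN; rewrite pq // qr. Qed.

Lemma eqmXD N p p' q q' :
  eqmX N p p' -> eqmX N q q' -> eqmX N (p + q) (p' + q').
Proof. by move=> pp qq i iN; rewrite !coefD pp // qq. Qed.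

Lemma eqmXN N p p' : eqmX N p p' -> eqmX N (- p) (- p').
Proof. by move=> pp i iN; rewrite !coefN pp. Qed.

Lemma eqmXB N p p' q q' :
  eqmX N p p' -> eqmX N q q' -> eqmX N (p - q) (p' - q').
Proof. by move=> pp qq; apply: eqmXD => //; apply: eqmXN. Qed.

Lemma eqmXM N p p' q q' :
  eqmX N p p' -> eqmX N q q' -> eqmX N (p * q) (p' * q').
Proof.
move=> pp qq i iN; rewrite !coefM; apply: eq_bigr => j _.
have ji : (j <= i)%N by rewrite -ltnS.
by rewrite pp ?qq ?(leq_ltn_trans ji iN) // (leq_ltn_trans (leq_subr _ _) iN).
Qed.

Lemma eqmX_prod N (I : Type) (r : seq I) (F F' : I -> {poly R}) :
  (forall i, eqmX N (F i) (F' i)) ->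
  eqmX N (\prod_(i <- r) F i) (\prod_(i <- r) F' i).
Proof.
by move=> FF; elim/big_ind2: _ => // p p' q q' pp qq; apply: eqmXM.
Qed.

Lemma eqmX_Xn N m p : (N <= m)%N -> eqmX N (p * 'X^m) 0.
Proof. by move=> Nm i iN; rewrite coefMXn (leq_trans iN Nm) coef0. Qed.

Lemma eqmX_leq M N p q : (M <= N)%N -> eqmX N p q -> eqmX M p q.
Proof. by move=> MN pq i iM; apply/pq/(leq_trans iM). Qed.

(** The witness is the truncated geometric series of [1 / (1 - (1 - p))]; the error [(1 - p) ^+ N]
    is divisible by ['X^N]. *)
Lemma eqmX_inv N p : p`_0 = 1 -> exists q, eqmX N (p * q) 1.
Proof.
move=> p0; exists (\sum_(j < N) (1 - p) ^+ j).
have -> : p * \sum_(j < N) (1 - p) ^+ j = 1 - (1 - p) ^+ N.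
  rewrite -[X in X * _](subKr 1) -[X in _ = X - _](expr1n _ N).
  rewrite subrXX; congr (_ * _); apply: eq_bigr => i _.
  by rewrite expr1n mul1r.
move=> i iN; rewrite coefB; set b := _ ^+ _.
suff -> : b`_i = 0 by rewrite subr0.
have : exists q, 1 - p = q * 'X.
  exists (\poly_(i < size p) (1 - p)`_i.+1); apply/polyP => -[|k].
    by rewrite coefB coef1 p0 subrr coefMX.
  rewrite coefMX /= coef_poly; case: ltnP => // szp.
  by rewrite coefB coef1 /= nth_default ?subr0 // (leq_trans szp).
by case=> q def; rewrite /b def exprMn coefMXn iN.
Qed.

(** [A] is the logarithmic derivative [X G' / G] modulo [X^N], stated without division; it takes the
    place of logarithms of series. *)
Definition dlog N A G := eqmX N ('X * G^`()) (A * G).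

Lemma coef_XM_deriv G i : ('X * G^`())`_i = G`_i *+ i.
Proof. by rewrite coefXM; case: i => [|i] //=; rewrite coef_deriv. Qed.

Lemma dlog_congr N A A' G G' :
  eqmX N A A' -> eqmX N G G' -> dlog N A G -> dlog N A' G'.
Proof.
move=> AA GG AG; apply: eqmX_trans (eqmXM AA GG).
by apply: eqmX_trans AG => i iN; rewrite !coef_XM_deriv GG.
Qed.

Lemma dlog_congr_log N A A' G : eqmX N A A' -> dlog N A G -> dlog N A' G.
Proof. by move=> AA; apply: dlog_congr AA _. Qed.

Lemma dlogM N A G A' G' :
  dlog N A G -> dlog N A' G' -> dlog N (A + A') (G * G').
Proof.
rewrite /dlog => AG AG'.
have -> : 'X * (G * G')^`() = ('X * G^`()) * G' + G * ('X * G'^`()).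
  by rewrite derivM; ring.
have -> : (A + A') * (G * G') = (A * G) * G' + G * (A' * G') by ring.
by apply: eqmXD; apply: eqmXM.
Qed.

Lemma dlog_prod N (I : Type) (r : seq I) (A G : I -> {poly R}) :
  (forall i, dlog N (A i) (G i)) ->
  dlog N (\sum_(i <- r) A i) (\prod_(i <- r) G i).
Proof.
move=> AG; elim/big_ind2: _ => //; last by move=> *; apply: dlogM.
by rewrite /dlog derivC mulr0 mul0r.
Qed.

Lemma dlog_coef N A G i : dlog N A G -> (i < N)%N ->
  G`_i *+ i = \sum_(j < i.+1) A`_j * G`_(i - j).
Proof. by move=> AG iN; rewrite -coef_XM_deriv AG // coefM. Qed.

Lemma dlog_coef0 N A G : dlog N A G -> G`_0 = 1 -> (0 < N)%N -> A`_0 = 0.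
Proof.
move=> AG G0 N0; have := dlog_coef AG N0.
by rewrite mulr0n big_ord1 /= G0 mulr1.
Qed.

(** The relation reads [i G_i = \sum_(0 < j <= i) A_j G_(i-j)], because [A_0 = 0]; without torsion
    it determines each coefficient from the earlier ones. *)
Lemma dlog_unique N A G G' :
    (forall k (x : R), x *+ k.+1 = 0 -> x = 0) ->
  dlog N A G -> dlog N A G' -> G`_0 = 1 -> G'`_0 = 1 -> eqmX N G G'.
Proof.
move=> tf AG AG' G0 G0'; elim/ltn_ind=> -[|i] IH iN; first by rewrite G0 G0'.
apply/eqP; rewrite -subr_eq0; apply/eqP/(tf i).
rewrite mulrnBl (dlog_coef AG iN) (dlog_coef AG' iN) -sumrB.
rewrite big_ord_recl (dlog_coef0 AG G0) ?(leq_ltn_trans _ iN) // !mul0r subrr.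
rewrite add0r big1 // => j _; rewrite lift0 subSS.
have ji : (i - j < i.+1)%N by rewrite ltnS leq_subr.
by rewrite IH ?subrr // (ltn_trans ji).
Qed.

Lemma dlog_unique_log N A A' G :
  dlog N A G -> dlog N A' G -> G`_0 = 1 -> eqmX N A A'.
Proof.
move=> AG AG' G0; have [V GV] := eqmX_inv N G0.
have inv B : eqmX N B (B * G * V).
  by rewrite -mulrA -{1}[B]mulr1; apply: eqmXM => //; apply: eqmX_sym.
apply: eqmX_trans (inv A) _; apply: eqmX_trans (eqmX_sym (inv A')).
by apply: eqmXM => //; apply: eqmX_trans AG'; apply: eqmX_sym.
Qed.

Lemma dlog_exists N G : G`_0 = 1 -> exists A, dlog N A G.
Proof.
move=> G0; have [V GV] := eqmX_inv N G0; exists ('X * G^`() * V).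
rewrite /dlog -mulrA -{1}['X * _]mulr1; apply: eqmXM => //.
by rewrite mulrC; apply: eqmX_sym.
Qed.

Definition scaleX (c : R) p := \poly_(i < size p) (c ^+ i * p`_i).

Lemma coef_scaleX c p i : (scaleX c p)`_i = c ^+ i * p`_i.
Proof. by rewrite coef_poly; case: ltnP => // pi; rewrite nth_default ?mulr0. Qed.

Lemma dlog_scaleX N c A G : dlog N A G -> dlog N (scaleX c A) (scaleX c G).
Proof.
move=> AG i iN; rewrite coef_XM_deriv coef_scaleX -mulrnAr (dlog_coef AG iN).
rewrite coefM mulr_sumr; apply: eq_bigr => j _; rewrite !coef_scaleX.
have /subnKC {1}<- : (j <= i)%N by rewrite -ltnS.
by rewrite exprD; ring.
Qed.

Definition geo N (c : R) := \poly_(k < N) c ^+ k.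

Lemma dlog_geo N c : dlog N (geo N c - 1) (geo N c).
Proof.
move=> i iN; rewrite coef_XM_deriv coef_poly iN.
rewrite coefM big_ord_recl /= coefB coef1 coef_poly /=.
rewrite (leq_ltn_trans _ iN) // expr0 subrr mul0r add0r.
rewrite (eq_bigr (fun=> c ^+ i)) ?sumr_const ?card_ord // => j _.
rewrite coefB coef1 subr0 !coef_poly.
have ji : (j.+1 <= i)%N by [].
by rewrite (leq_ltn_trans ji iN) (leq_ltn_trans (leq_subr _ _) iN) -exprD subnKC.
Qed.

Lemma geoM N c : (geo N c) * (1 - c *: 'X) = 1 - c ^+ N *: 'X^N.
Proof.
rewrite /geo poly_def -!exprZn -[1 - (c *: 'X) ^+ N](opprB _ 1).
rewrite subrX1 -mulNr opprB mulrC.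
by congr (_ * _); apply: eq_bigr => i _; rewrite exprZn.
Qed.

Lemma dlog_linear N c : dlog N (1 - geo N c) (1 - c *: 'X).
Proof.
rewrite /dlog derivB derivC derivZ derivX mulrBl mul1r geoM.
have -> : 'X * (0 - c *: 1) = (1 - c *: 'X) - 1 :> {poly R}.
  by rewrite -!mul_polyC; ring.
apply: eqmXB => //; rewrite -{1}(subr0 1); apply: eqmXB => //.
by rewrite -mul_polyC; apply/eqmX_sym/eqmX_Xn.
Qed.

Definition psums N s (y : 'I_s -> R) := \sum_(j < s) (geo N (y j) - 1).

Lemma coef_psums N s (y : 'I_s -> R) k : (k < N)%N ->
  (psums N y)`_k = if k == 0%N then 0 else \sum_(j < s) y j ^+ k.
Proof.
move=> kN; rewrite coef_sum.
have [->|k0] := eqVneq k 0%N.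
  by rewrite big1 // => j _; rewrite coefB coef1 coef_poly (leq_ltn_trans _ kN) ?subrr.
by apply: eq_bigr => j _; rewrite coefB coef1 (negPf k0) coef_poly kN subr0.
Qed.

Lemma dlog_prod_linear N s (y : 'I_s -> R) :
  dlog N (- psums N y) (\prod_(j < s) (1 - y j *: 'X)).
Proof.
rewrite -sumrN; apply: dlog_prod => j; rewrite opprB; exact: dlog_linear.
Qed.

Lemma dlog_prod_geo N s (y : 'I_s -> R) :
  dlog N (psums N y) (\prod_(j < s) geo N (y j)).
Proof. by apply: dlog_prod => j; apply: dlog_geo. Qed.

Lemma coef_prod_sum (I J : finType) (c : I -> J -> R) (w : I -> J -> nat) n :
  (\prod_i \sum_j c i j *: 'X^(w i j))`_n =
  \sum_(f : {ffun I -> J} | (\sum_i w i (f i) == n)%N) \prod_i c i (f i).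
Proof.
rewrite bigA_distr_bigA coef_sum [RHS]big_mkcond; apply: eq_bigr => f _.
rewrite scaler_prod -expr_sum coefZ coefXn eq_sym.
by case: eqP => _; rewrite ?mulr1 ?mulr0.
Qed.

End TruncatedSeries.

(** * The Cauchy identity *)

Section Exponential.
Variables (K : numFieldType) (R : comAlgType K).

Definition texp N k (a : R) : {poly R} :=
  \sum_(j < N) (j`!%:R^-1 *: a ^+ j) *: 'X^(k * j).

Lemma dlog_texp N k a : (0 < k)%N -> dlog N ((a *+ k) *: 'X^k) (texp N k a).
Proof.
move=> k0; rewrite /dlog /texp.
pose g j : {poly R} := (j`!%:R^-1 *: a ^+ j.+1) *: 'X^(k * j.+1) *+ k.
have -> : (a *+ k) *: 'X^k * (\sum_(j < N) (j`!%:R^-1 *: a ^+ j) *: 'X^(k * j))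
    = \sum_(j < N) g j.
  rewrite mulr_sumr; apply: eq_bigr => j _; rewrite /g -scalerAl -scalerAr.
  rewrite scalerA -exprD mulnS scalerMnl; congr (_ *: _).
  by rewrite exprS mulrnAl -scalerAr.
have -> : 'X * (\sum_(j < N) (j`!%:R^-1 *: a ^+ j) *: 'X^(k * j))^`()
    = \sum_(j < N) (if val j is j'.+1 then g j' else 0) :> {poly R}.
  rewrite raddf_sum mulr_sumr; apply: eq_bigr => -[[|j] jN] _ /=.
    by rewrite muln0 derivZ derivC scaler0 mulr0.
  rewrite derivZ derivXn -scalerAr mulrnAr -exprS prednK ?muln_gt0 ?k0 //.
  rewrite /g -!scalerMnr [X in _ *+ X]mulnC mulrnA; congr (_ *+ _).
  rewrite scalerMnl factS; congr (_ *: _).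
  rewrite -scaler_nat scalerA natrM invfM mulrA divff ?mul1r //.
  by rewrite pnatr_eq0.
(* After the index shift the sums differ only by the last [g], whose exponent is at least the
   truncation order. *)
case: N => [//|N].
rewrite big_ord_recl big_ord_recr /= add0r -{1}[\sum_(i < N) _]addr0.
apply: eqmXD => //; apply: eqmX_sym.
rewrite /g scalerMnl -mul_polyC; apply: eqmX_Xn.
by rewrite leq_pmull.
Qed.

Lemma texp0 N k a : (0 < k)%N -> (texp N.+1 k a)`_0 = 1.
Proof.
move=> k0; rewrite /texp big_ord_recl coefD coefZ coefXn muln0 mulr1 coef_sum.
rewrite big1 => [|j _]; first by rewrite addr0 expr0 fact0 invr1 scale1r.
by rewrite coefZ coefXn eq_sym muln_eq0 (gtn_eqF k0) mulr0.
Qed.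

Lemma coef_prod_texp n (a : nat -> R) :
  (\prod_(k < n) texp n.+1 k.+1 (a k))`_n =
  \sum_(l in partitions n) \prod_(k < n) ((l k)`!%:R^-1 *: a k ^+ l k).
Proof.
rewrite /texp coef_prod_sum; apply: eq_bigl => l.
by rewrite inE.
Qed.

Lemma torsion_free k (x : R) : x *+ k.+1 = 0 -> x = 0.
Proof.
move/eqP; rewrite -scaler_nat scaler_eq0 pnatr_eq0 /=.
by move/eqP.
Qed.

End Exponential.

Lemma coef0_prod_eq1 (R : comNzRingType) (I : finType) (F : I -> {poly R}) :
  (forall i, (F i)`_0 = 1) -> (\prod_i F i)`_0 = 1.
Proof.
by move=> F0; rewrite coef0_prod big1.
Qed.

(** * Monomial symmetric functions *)

Section MonomialSymmetric.
Variables (n s : nat).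
Implicit Types (f : {ffun 'I_s -> 'I_n.+1}) (l : {ffun 'I_n -> 'I_n.+1}).

(** [inord] loses nothing when the exponents sum to [n], since then no nonzero exponent occurs more
    than [n] times. *)
Definition exp_type f : {ffun 'I_n -> 'I_n.+1} :=
  [ffun k : 'I_n => inord #|[set j | f j == k.+1 :> nat]|].

(** The monomial symmetric function [m_l]: one term per exponent vector of type [l], so each
    monomial is counted once. *)
Definition msf (R : pzSemiRingType) l (y : 'I_s -> R) : R :=
  \sum_(f : {ffun 'I_s -> 'I_n.+1} |
        (\sum_j f j == n)%N && (exp_type f == l)) \prod_j y j ^+ f j.

Lemma big_exp_type (T : Type) (idx : T) (op : Monoid.com_law idx)
    (F : nat -> T) f :
  \big[op/idx]_j F (f j) =
  op (\big[op/idx]_(j | f j == 0 :> nat) F 0)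
     (\big[op/idx]_(k < n) \big[op/idx]_(j | f j == k.+1 :> nat) F k.+1).
Proof.
rewrite (partition_big f predT) //= big_ord_recl.
congr (op _ _).
  by apply: eq_big => [j|j /eqP ->].
by apply: eq_bigr => k _; apply: eq_big => [j|j /eqP ->].
Qed.

Lemma card_sum_exp f :
  (\sum_j f j = \sum_(k < n) k.+1 * #|[set j | f j == k.+1 :> nat]|)%N.
Proof.
rewrite (big_exp_type addn id) /= big1_eq add0n; apply: eq_bigr => k _.
by rewrite sum_nat_const mulnC cardsE.
Qed.

Lemma exp_typeE f (k : 'I_n) : (\sum_j f j = n)%N ->
  exp_type f k = #|[set j | f j == k.+1 :> nat]| :> nat.
Proof.
rewrite ffunE card_sum_exp => sum_f; rewrite inordK // ltnS.
by rewrite -[leqRHS]sum_f (bigD1 k) //= mulSn -addnA leq_addr.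
Qed.

Lemma exp_type_partition f :
  (\sum_j f j = n)%N -> exp_type f \in partitions n.
Proof.
move=> sum_f; rewrite inE -[eqbRHS]sum_f card_sum_exp; apply/eqP/eq_bigr => k _.
by rewrite exp_typeE.
Qed.

Lemma prod_exp_type (R : comPzSemiRingType) (h : nat -> R) f :
  h 0%N = 1 -> (\sum_j f j = n)%N ->
  \prod_j h (f j) = \prod_(k < n) h k.+1 ^+ exp_type f k.
Proof.
move=> h0 sum_f; rewrite big_exp_type /= h0 big1_eq mul1r; apply: eq_bigr => k _.
by rewrite prodr_const exp_typeE // cardsE.
Qed.

End MonomialSymmetric.

Section Cauchy.
Variables (K : numFieldType) (R : comAlgType K) (n : nat) (h : nat -> R).
Variable P : {poly R}.
Hypotheses (h0 : h 0%N = 1) (hP : dlog n.+1 P (\poly_(i < n.+1) h i)).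

(** Substituting [y_j X] for [X] multiplies the k-th logarithmic coefficient by [y_j ^+ k]. *)
Lemma dlog_prod_scaleX s (y : 'I_s -> K) :
  dlog n.+1 (\poly_(k < n.+1) ((psums n.+1 y)`_k *: P`_k))
    (\prod_(j < s) scaleX (y j)%:A (\poly_(i < n.+1) h i)).
Proof.
apply: (@dlog_congr_log _ _ (\sum_(j < s) scaleX (y j)%:A P)); last first.
  by apply: dlog_prod => j; apply: dlog_scaleX.
move=> k kn; rewrite coef_poly kn coef_psums // coef_sum.
under eq_bigr => j _ do rewrite coef_scaleX -in_algE -rmorphXn /= mulr_algl.
case: eqP => [->|_]; last by rewrite scaler_suml.
(* In degree 0 the powers of the [y j] sum to [s] whereas [psums] has 0; the vanishing constant
   coefficient of [P] reconciles them. *)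
have P0 : P`_0 = 0.
  by apply: dlog_coef0 hP _ _ => //; rewrite coef_poly h0.
by rewrite big1 ?P0 ?scale0r // => j _; rewrite scaler0.
Qed.

(** Choose the exponent [f j] in the j-th factor and group the choices by type. *)
Lemma coef_prod_scaleX s (y : 'I_s -> K) :
  (\prod_(j < s) scaleX (y j)%:A (\poly_(i < n.+1) h i))`_n =
  \sum_(l in partitions n) msf l y *: \prod_(k < n) h k.+1 ^+ l k.
Proof.
transitivity ((\prod_(j < s) \sum_(i < n.+1) (y j ^+ i *: h i) *: 'X^i)`_n).
  apply: (@eqmX_prod R n.+1) => // j i iN; rewrite coef_scaleX coef_poly iN.
  rewrite coef_sum (bigD1 (Ordinal iN)) //= big1 => [|k nek].
    rewrite addr0 coefZ coefXn eqxx mulr1.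
    by rewrite -in_algE -rmorphXn /= mulr_algl.
  rewrite coefZ coefXn; case: eqP => [eik|_]; last by rewrite mulr0.
  by case/eqP: nek; apply: val_inj.
rewrite coef_prod_sum.
rewrite (partition_big (@exp_type n s) (mem (partitions n))) /=; last first.
  by move=> f /eqP; apply: exp_type_partition.
apply: eq_bigr => l _; rewrite scaler_suml; apply: eq_bigr => f.
case/andP=> /eqP sf /eqP <-; rewrite -prod_exp_type //.
by rewrite -scaler_prod.
Qed.

(** Both sides are coefficients of [X^n] in series with constant term 1 and the same logarithmic
    derivative: a product of exponentials, and [\prod_j H(y_j X)]. The coefficients of [P] play the
    role of the power sums of [x]. *)
Lemma cauchy_identity s (y : 'I_s -> K) :
  \sum_(l in partitions n) \prod_(k < n)
     ((l k)`!%:R^-1 *: (((\sum_j y j ^+ k.+1) / k.+1%:R) *: P`_k.+1) ^+ l k) =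
  \sum_(l in partitions n) msf l y *: \prod_(k < n) h k.+1 ^+ l k.
Proof.
pose a k : R := ((\sum_j y j ^+ k.+1) / k.+1%:R) *: P`_k.+1.
rewrite -(coef_prod_texp n a) -coef_prod_scaleX.
apply: (@dlog_unique _ n.+1
  (\poly_(k < n.+1) ((psums n.+1 y)`_k *: P`_k))) => //; first exact: torsion_free.
- apply: (@dlog_congr_log _ _ (\sum_(k < n) (a k *+ k.+1) *: 'X^(k.+1)));
    last by apply: dlog_prod => k; apply: dlog_texp.
  case=> [|k] kn; rewrite coef_poly kn coef_psums // coef_sum /=.
    by rewrite scale0r big1 // => j _; rewrite coefZ coefXn mulr0.
  rewrite ltnS in kn; rewrite (bigD1 (Ordinal kn)) //= big1 => [|j nej].
    rewrite addr0 coefZ coefXn eqxx mulr1 /a -scaler_nat scalerA mulrC divfK //.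
    by rewrite pnatr_eq0.
  rewrite coefZ coefXn eqSS; case: eqP => [eik|_]; last by rewrite mulr0.
  by case/eqP: nej; apply: val_inj.
- exact: dlog_prod_scaleX.
- by apply: coef0_prod_eq1 => k; apply: texp0.
by apply: coef0_prod_eq1 => j; rewrite coef_scaleX expr0 mul1r coef_poly h0.
Qed.

End Cauchy.

(* Comparing coefficients in the Cauchy identity for independent [h_k] shows
   that [msf] only depends on the power sums, not on the number of variables. *)
Lemma msf_stable (K : numFieldType) n s s' (y : 'I_s -> K) (y' : 'I_s' -> K) l :
    (forall k, (0 < k <= n)%N -> \sum_j y j ^+ k = \sum_j y' j ^+ k) ->
  l \in partitions n -> msf l y = msf l y'.
Proof.
move=> eqp lP.
(* [h 1, ..., h n] are the indeterminates, so distinct partitions give distinct monomials. *)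
pose h k : {mpoly K[n]} :=
  if k is k'.+1 then oapp (fun i => 'X_i) 0 (insub k') else 1.
have hE (k : 'I_n) : h k.+1 = 'X_k by rewrite /= valK.
have [P hP] := @dlog_exists _ n.+1 (\poly_(i < n.+1) h i) (coef_poly _ _ _).
have c s0 (y0 : 'I_s0 -> K) := cauchy_identity (erefl : h 0%N = 1) hP y0.
have : (\sum_(l in partitions n) msf l y *: \prod_(k < n) h k.+1 ^+ l k)
  = \sum_(l in partitions n) msf l y' *: \prod_(k < n) h k.+1 ^+ l k.
  rewrite -!c; apply: eq_bigr => l' _; apply: eq_bigr => k _.
  by rewrite (eqp k.+1) ?ltn_ord.
have hl (l' : {ffun 'I_n -> 'I_n.+1}) : \prod_(k < n) h k.+1 ^+ l' k =
    'X_[[multinom l' i : nat | i < n]].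
  by rewrite mpolyXE_id; apply: eq_bigr => k _; rewrite hE mnmE.
move/(congr1 (mcoeff [multinom l i : nat | i < n])).
rewrite !raddf_sum /= (bigD1 l) //= [in RHS](bigD1 l) //=.
have coefl (l' : {ffun 'I_n -> 'I_n.+1}) c0 : l' != l ->
  (c0 *: \prod_(k < n) h k.+1 ^+ l' k)@_[multinom l i : nat | i < n] = 0.
  move=> ne; rewrite mcoeffZ hl mcoeffX; case: eqP => [e|_]; last by rewrite mulr0.
  case/eqP: ne; apply/ffunP => i; apply: val_inj.
  by have /mnmP/(_ i) := e; rewrite !mnmE.
rewrite [X in _ + X]big1; last by move=> l' /andP[_ ne]; apply: coefl.
rewrite [X in _ = _ + X]big1; last by move=> l' /andP[_ ne]; apply: coefl.
by rewrite !addr0 !mcoeffZ hl mcoeffX eqxx !mulr1.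
Qed.

(** * Complete and elementary symmetric functions *)

Lemma coef_prod_geo_complete n r k : (k <= n)%N ->
  (\prod_(i < r) geo n.+1 ('X_i : {mpoly rat[r]}))`_k = complete k r.
Proof.
move=> kn; rewrite /complete.
under eq_bigr => i _ do rewrite /geo poly_def.
rewrite coef_prod_sum.
pose h (m : 'X_{1..r < k.+1}) : {ffun 'I_r -> 'I_n.+1} := [ffun i => inord (m i)].
pose g (f : {ffun 'I_r -> 'I_n.+1}) : 'X_{1..r < k.+1} :=
  insubd bm0 [multinom f i : nat | i < r].
have hE (m : 'X_{1..r < k.+1}) i : h m i = m i :> nat.
  rewrite ffunE inordK // ltnS (leq_trans _ kn) // -ltnS.
  by apply: leq_ltn_trans (bmdeg m); rewrite mdegE (bigD1 i) //= leq_addr.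
have gE (f : {ffun 'I_r -> 'I_n.+1}) : (\sum_i f i == k)%N ->
    g f = [multinom f i : nat | i < r] :> 'X_{1..r}.
  move/eqP=> fk; rewrite val_insubd ifT // mdegE ltnS -[leqRHS]fk leq_sum // => i _.
  by rewrite mnmE.
rewrite (reindex_onto h g) /=; last first.
  by move=> f fk; apply/ffunP => i; apply: val_inj; rewrite /= hE gE // mnmE.
apply: eq_big => [m|m _]; last first.
  by rewrite mpolyXE_id; apply: eq_bigr => i _; rewrite hE.
have -> : (\sum_i h m i = mdeg m)%N.
  by rewrite mdegE; apply: eq_bigr => i _; rewrite hE.
rewrite andb_idr // => mk; apply/eqP/val_inj/mnmP => i.
rewrite /= gE ?mnmE ?hE // -(eqP mk) mdegE.
by apply/eqP/eq_bigr => j _; rewrite hE.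
Qed.

(** Newton's identities: the series of the [complete k r] is [\prod_i 1 / (1 - x_i X)]. *)
Lemma dlog_complete n r :
  dlog n.+1 (\poly_(k < n.+1) (if k == 0%N then 0 else powersum k r))
            (\poly_(k < n.+1) complete k r).
Proof.
have := @dlog_prod_geo _ n.+1 _ (fun i : 'I_r => 'X_i : {mpoly rat[r]}).
apply: dlog_congr => k kn.
  by rewrite coef_psums // coef_poly kn.
by rewrite coef_poly kn coef_prod_geo_complete.
Qed.

Lemma complete0 r : complete 0 r = 1.
Proof.
rewrite -(@coef_prod_geo_complete 0) //; apply: coef0_prod_eq1 => i.
by rewrite coef_poly.
Qed.

Lemma dlog_map (R S : comNzRingType) (f : {rmorphism R -> S}) N A G :
  dlog N A G -> dlog N (map_poly f A) (map_poly f G).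
Proof.
move=> AG i iN; rewrite coef_XM_deriv coef_map -rmorphMn -coef_XM_deriv AG //.
by rewrite -rmorphM coef_map.
Qed.

Definition esymf (R : pzSemiRingType) s k (y : 'I_s -> R) : R :=
  \sum_(J : {set 'I_s} | #|J| == k) \prod_(i in J) y i.

Lemma coef_prod_linear (R : comNzRingType) s (y : 'I_s -> R) k :
  (\prod_(j < s) (1 - y j *: 'X))`_k = (-1) ^+ k * esymf k y.
Proof.
under eq_bigr => j _ do rewrite addrC.
rewrite bigA_distr coef_sum mulr_sumr [RHS]big_mkcond /=.
apply: eq_bigr => J _; rewrite -big_mkcond /=.
under eq_bigr => j _ do rewrite -scaleNr.
rewrite scaler_prod prodr_const coefZ coefXn eq_sym.
by case: eqP => [<-|_]; rewrite ?mulr0 // prodrN mulr1.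
Qed.

Lemma esymf0 (R : comNzRingType) s (y : 'I_s -> R) : esymf 0 y = 1.
Proof.
have := coef_prod_linear y 0; rewrite mul1r => <-; apply: coef0_prod_eq1 => j.
by rewrite coefB coef1 coefZ coefX mulr0 subr0.
Qed.

(** Up to sign the [esymf k y] are the coefficients of [\prod_j (1 - y_j X)], whose logarithmic
    derivative is [- psums]. *)
Lemma psum_esymf (R : comNzRingType) n s s' (y : 'I_s -> R) (y' : 'I_s' -> R) :
    (forall k, (k <= n)%N -> esymf k y = esymf k y') ->
  forall k, (0 < k <= n)%N -> \sum_j y j ^+ k = \sum_j y' j ^+ k.
Proof.
move=> eqe k /andP[k0 kn].
have F0 t (z : 'I_t -> R) : (\prod_(j < t) (1 - z j *: 'X))`_0 = 1.
  by rewrite coef_prod_linear esymf0 mulr1.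
have eF : eqmX n.+1 (\prod_(j < s') (1 - y' j *: 'X)) (\prod_(j < s) (1 - y j *: 'X)).
  by move=> i iN; rewrite !coef_prod_linear eqe.
have := dlog_congr (@eqmX_refl _ _ _) eF (@dlog_prod_linear _ n.+1 _ y').
move/(dlog_unique_log (@dlog_prod_linear _ n.+1 _ y))/(_ (F0 _ _))/(_ k kn).
rewrite !coefN => /oppr_inj; rewrite !coef_psums //.
by rewrite (gtn_eqF k0).
Qed.

(** The [y j] are the roots of the monic polynomial whose coefficients are the signed [E k]; the
    last clause records this. *)
Lemma exists_esymf (K : closedFieldType) n (E : nat -> K) : E 0%N = 1 ->
  exists y : 'I_n -> K, (forall k, (k <= n)%N -> esymf k y = E k) /\
    forall j, \sum_(k < n.+1) (-1) ^+ k * E k * y j ^+ (n - k) = 0.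
Proof.
move=> E0.
pose Q : {poly K} := \poly_(i < n.+1) ((-1) ^+ (n - i) * E (n - i)%N).
have Qn : Q`_n = 1 by rewrite coef_poly ltnSn subnn E0 mulr1.
have szQ : size Q = n.+1 by rewrite size_poly_eq // subnn E0 mulr1 oner_eq0.
have lQ : lead_coef Q = 1 by rewrite lead_coefE szQ.
have [r] := closed_field_poly_normal Q; rewrite lQ scale1r => Qr.
have szr : size r == n by rewrite -eqSS -(size_prod_XsubC _ id) -Qr szQ.
exists (tnth (Tuple szr)); split=> [k kn | j].
  have kn' : (k < n.+1)%N by [].
  have := mroots_coeff (Tuple szr) (Ordinal kn').
  rewrite /= -Qr coef_poly ltnS leq_subr subKn //.
  move/(can_inj (signrMK k)) ->.
  rewrite /esymf rmorph_sum /=; apply: eq_bigr => J _.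
  by rewrite rmorph_prod; apply: eq_bigr => i _; rewrite /= mevalXU.
have : Q.[tnth (Tuple szr) j] == 0.
  by rewrite -/(root _ _) Qr root_prod_XsubC (mem_tnth j (Tuple szr)).
rewrite horner_poly => /eqP Qy; rewrite -[RHS]Qy (reindex_inj rev_ord_inj) /=.
apply: eq_bigr => i _; rewrite subSS subKn //.
by rewrite -ltnS.
Qed.

(** * Integral polynomials in the elementary symmetric functions *)

Section FundamentalTheorem.
Variable n : nat.

(** The variable of index [i] in [t] stands for [e_(i+1)] and has weight [i.+1], hence the bound on
    the monomials. *)
Lemma sym_esymf (q : {mpoly int[n]}) : q \is mpoly.symmetric ->
    (msize q <= n.+1)%N ->
  exists2 t : {mpoly int[n]},
    forall (K : comNzRingType) (y : 'I_n -> K),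
      mmap intr y q = mmap intr (fun i : 'I_n => esymf i.+1 y) t &
    forall m, m \in msupp t -> (\sum_(i < n) i.+1 * m i <= n)%N.
Proof.
move=> /sym_fundamental[t [tq tw]] qn; exists t => [K y|m mt].
  rewrite -tq /comp_mpoly {2}/mmap raddf_sum; apply: eq_bigr => m _ /=.
  rewrite mul_mpolyC mmapZ; congr (_ * _).
  rewrite /mmap1 rmorph_prod; apply: eq_bigr => i _.
  rewrite rmorphXn /= tnth_mktuple; congr (_ ^+ _).
  rewrite /mesym rmorph_sum; apply: eq_bigr => J _.
  by rewrite rmorph_prod; apply: eq_bigr => j _; rewrite /= mmapX mmap1U.
have := leq_trans (mmeasure_mnm_lt (Measure.clone _ mnmwgt _) mt) (leq_trans tw qn).
rewrite ltnS; apply: leq_trans; rewrite /= /mnmwgt.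
by apply/eq_leq/eq_bigr => i _; rewrite mulnC.
Qed.

Let X := fun i : 'I_n => 'X_i : {mpoly int[n]}.

Lemma msf_esymf (l : {ffun 'I_n -> 'I_n.+1}) : exists2 t : {mpoly int[n]},
    forall (K : comNzRingType) (y : 'I_n -> K),
      msf l y = mmap intr (fun i : 'I_n => esymf i.+1 y) t &
    forall m, m \in msupp t -> (\sum_(i < n) i.+1 * m i <= n)%N.
Proof.
have [||t tE tw] := @sym_esymf (msf l X); last first.
- exists t => // K y; rewrite -tE /msf rmorph_sum; apply: eq_bigr => f _.
  by rewrite rmorph_prod; apply: eq_bigr => i _; rewrite rmorphXn /= mmapX mmap1U.
- apply: leq_trans (msize_sum _ _ _) _; apply/bigmax_leqP => f /andP[/eqP fn _].
  have -> : \prod_j X j ^+ f j = 'X_[[multinom f i : nat | i < n]].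
    by rewrite mpolyXE_id; apply: eq_bigr => i _; rewrite mnmE.
  rewrite msizeX ltnS mdegE -[leqRHS]fn; apply/eq_leq/eq_bigr => i _.
  by rewrite mnmE.
apply/issymP => s; rewrite /msf rmorph_sum /=.
pose g (f : {ffun 'I_n -> 'I_n.+1}) := [ffun i => f (s i)].
have g_inj : injective g.
  move=> f f' /ffunP e; apply/ffunP => i.
  by have := e ((s^-1)%g i); rewrite !ffunE permKV.
rewrite (reindex_inj g_inj) /=; apply: eq_big => [f|f _].
  congr (_ && _).
    congr (_ == _); rewrite [RHS](reindex_inj (@perm_inj _ s)).
    by apply: eq_bigr => i _; rewrite ffunE.
  congr (_ == _); apply/ffunP => k; rewrite !ffunE; congr (inord _).
  rewrite -!sum1dep_card [RHS](reindex_inj (@perm_inj _ s)).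
  by apply: eq_bigl => i; rewrite ffunE.
rewrite rmorph_prod [RHS](reindex_inj (@perm_inj _ s)).
apply: eq_bigr => i _; rewrite rmorphXn /= ffunE; congr (_ ^+ _).
by rewrite /msym mmapX mmap1U.
Qed.

Lemma psum_poly_esymf k : (k <= n)%N -> exists t : {mpoly int[n]},
  forall (K : comNzRingType) (y : 'I_n -> K),
    \sum_j y j ^+ k = mmap intr (fun i : 'I_n => esymf i.+1 y) t.
Proof.
move=> kn; have [||t tE tw] := @sym_esymf (\sum_j X j ^+ k); last first.
- exists t => // K y; rewrite -tE rmorph_sum; apply: eq_bigr => j _.
  by rewrite rmorphXn /= mmapX mmap1U.
- apply: leq_trans (msize_sum _ _ _) _; apply/bigmax_leqP => j _.
  by rewrite /X mpolyXn msizeX mdegMn mdeg1 mul1n ltnS.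
apply/issymP => s; rewrite rmorph_sum [RHS](reindex_inj (@perm_inj _ s)).
by apply: eq_bigr => j _; rewrite rmorphXn /= /msym mmapX mmap1U.
Qed.

End FundamentalTheorem.

(** * Integrality and positivity *)

Lemma rmorph_mmap_intr (R S : comNzRingType) (f : {rmorphism R -> S}) n
    (h : 'I_n -> R) (t : {mpoly int[n]}) :
  f (mmap intr h t) = mmap intr (f \o h) t.
Proof.
rewrite /mmap rmorph_sum; apply: eq_bigr => m _.
rewrite rmorphM rmorph_int rmorph_prod; congr (_ * _).
by apply: eq_bigr => i _; rewrite rmorphXn.
Qed.

Lemma eq_mmap_intr (R : comNzRingType) n (h h' : 'I_n -> R) (t : {mpoly int[n]}) :
  h =1 h' -> mmap intr h t = mmap intr h' t.
Proof.
move=> hh; apply: eq_bigr => m _; congr (_ * _); apply: eq_bigr => i _.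
by rewrite hh.
Qed.

Lemma dvdn_factM a b : (a`! * b`! %| (a + b)`!)%N.
Proof.
by rewrite -(@bin_fact (a + b) a) ?leq_addr // addKn dvdn_mull.
Qed.

Lemma dvdn_fact_leq a b : (a <= b)%N -> (a`! %| b`!)%N.
Proof.
move/subnKC => <-; apply: dvdn_trans (dvdn_factM _ _).
exact: dvdn_mulr.
Qed.

Lemma dvdn_prod_fact n (a m : 'I_n -> nat) :
  (\prod_i (a i)`! ^ m i %| (\sum_i a i * m i)`!)%N.
Proof.
elim/big_ind2: _ => // [x s y t xs yt | i _].
  exact: dvdn_trans (dvdn_mul xs yt) (dvdn_factM _ _).
elim: (m i) => [|k IH]; first by rewrite muln0.
rewrite expnS mulnS; apply: dvdn_trans (dvdn_factM _ _).
exact: dvdn_mul.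
Qed.

(** A monomial of [t] evaluates to the inverse of a product of factorials whose arguments sum to at
    most [2 n]; that product divides [(2 n)!]. *)
Lemma mmap_inv_fact_int n (t : {mpoly int[n]}) :
    (forall m, m \in msupp t -> (\sum_(i < n) i.+1 * m i <= n)%N) ->
  (2 * n)`!%:R * mmap intr (fun i : 'I_n => (2 * i.+1)`!%:R^-1 : rat) t
    \is a Num.int.
Proof.
move=> tw; rewrite /mmap big_seq mulr_sumr; apply: rpred_sum => m mt.
rewrite mulrCA rpredM ?intr_int //.
have dvd : (\prod_(i < n) (2 * i.+1)`! ^ m i %| (2 * n)`!)%N.
  apply: dvdn_trans (dvdn_prod_fact _ _) (dvdn_fact_leq _).
  apply: leq_trans (leq_mul (leqnn 2) (tw m mt)).
  by rewrite big_distrr /= leq_sum // => i _; rewrite mulnA.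
rewrite /mmap1 -(divnK dvd) natrM natr_prod -mulrA -big_split /=.
rewrite [X in _ * X]big1 => [|i _].
  by rewrite mulr1 natr_int.
rewrite natrX -exprMn mulfV ?expr1n //.
by rewrite pnatr_eq0 -lt0n fact_gt0.
Qed.

(** * Positivity by approximating the cosine *)

Section Positivity.

(* [cosE k].[1/N] is the k-th elementary symmetric function of the reciprocals
   of the roots (in x = z^2) of ((1 + i z/N)^N + (1 - i z/N)^N) / 2, which
   tends to cos z. *)
Definition cosE k : {poly rat} :=
  (2 * k)`!%:R^-1 *: \prod_(i < 2 * k) (1 - i%:R *: 'X).

Lemma ffact_prodr (R : comPzRingType) N m :
  (N ^_ m)%:R = \prod_(i < m) (N%:R - i%:R) :> R.
Proof.
elim: m => [|m IH]; first by rewrite big_ord0 ffactn0.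
rewrite big_ord_recr /= -IH ffactnSr natrM.
have [mN|Nm] := leqP m N; first by rewrite natrB.
by rewrite ffact_small // !mul0r.
Qed.

Lemma cosE_inv k N : (0 < N)%N ->
  (cosE k).[N%:R^-1] = 'C(N, 2 * k)%:R / N%:R ^+ (2 * k).
Proof.
move=> N0; rewrite hornerZ horner_prod.
have Nn0 : N%:R != 0 :> rat by rewrite pnatr_eq0 -lt0n.
have fn0 : (2 * k)`!%:R != 0 :> rat by rewrite pnatr_eq0 -lt0n fact_gt0.
have -> : \prod_(i < 2 * k) (1 - i%:R *: 'X).[N%:R^-1] =
    (N ^_ (2 * k))%:R / N%:R ^+ (2 * k) :> rat.
  rewrite ffact_prodr -exprVn -[X in _ ^+ X]card_ord -prodr_const -big_split /=.
  by apply: eq_bigr => i _; rewrite !hornerE mulrBl divff.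
by rewrite -bin_ffact natrM mulrA [_^-1 * _]mulrC mulfK.
Qed.

Lemma cosE0 k : (cosE k).[0] = (2 * k)`!%:R^-1.
Proof.
rewrite hornerZ horner_prod big1 ?mulr1 // => i _.
by rewrite !(hornerE, subr0).
Qed.

Lemma sum_even_odd (V : nmodType) (F : nat -> V) M :
  \sum_(i < 2 * M) F i = \sum_(k < M) (F (2 * k)%N + F (2 * k).+1).
Proof.
elim: M => [|M IH]; first by rewrite !big_ord0.
by rewrite mulnS add2n 2!big_ord_recr big_ord_recr /= IH addrA.
Qed.

(** Odd powers of [w] cancel. The binomials with [2 k > N] vanish; keeping them matches the range of
    summation in [exists_esymf]. *)
Lemma sum_bin_even (R : comPzRingType) N (w : R) :
  (1 + w) ^+ N + (1 - w) ^+ N =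
  (\sum_(k < N.+1) 'C(N, 2 * k)%:R * (w ^+ 2) ^+ k) *+ 2.
Proof.
have E (z : R) : (1 + z) ^+ N = \sum_(i < 2 * N.+1) 'C(N, i)%:R * z ^+ i.
  rewrite exprDn (big_ord_widen (2 * N.+1)
    (fun i => (1 ^+ (N - i) * z ^+ i) *+ 'C(N, i)))
    ?leq_pmull //.
  rewrite big_mkcond; apply: eq_bigr => i _; rewrite expr1n mul1r mulr_natl.
  by case: ltnP => // /bin_small ->; rewrite mulr0n.
rewrite !E -big_split -sumrMnl /= (sum_even_odd (fun i =>
  'C(N, i)%:R * w ^+ i + 'C(N, i)%:R * (- w) ^+ i)).
apply: eq_bigr => k _; have e : (- w) ^+ (2 * k) = w ^+ (2 * k).
  by rewrite !exprM sqrrN.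
by rewrite (exprS w) (exprS (- w)) e mulNr mulrN subrr addr0 -exprM mulr2n.
Qed.

Lemma esymf_approximant N : (0 < N)%N ->
  exists2 y : 'I_N -> algC, forall j, 0 <= y j &
    forall k, (k <= N)%N -> esymf k y = ratr (cosE k).[N%:R^-1].
Proof.
move=> N0; pose E k : algC := ratr (cosE k).[N%:R^-1].
have E0 : E 0%N = 1.
  by rewrite /E cosE_inv // muln0 bin0 expr0 divr1 rmorph1.
have [y [ey root_y]] := exists_esymf N E0; exists y => // j.
have Nn0 : N%:R != 0 :> algC by rewrite pnatr_eq0 -lt0n.
(* Zeros do occur, since [E k = 0] for [2 k > N]. *)
have [->//|y0] := eqVneq (y j) 0.
(* For [y j = 1 / z^2] this is [i z / N] up to sign, and the equation of [y j] becomes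
   [(1 + w)^N + (1 - w)^N = 0]. *)
pose w := sqrtC (- (N%:R ^+ 2 * y j)^-1).
have w2 : w ^+ 2 = - (N%:R ^+ 2 * y j)^-1 by rewrite sqrtCK.
have sum0 : \sum_(k < N.+1) 'C(N, 2 * k)%:R * (w ^+ 2) ^+ k = 0.
  apply: (mulIf (expf_neq0 N y0)); rewrite mul0r -[RHS](root_y j) mulr_suml.
  apply: eq_bigr => k _; rewrite /E cosE_inv // fmorph_div rmorphXn !rmorph_nat.
  have kN : (k <= N)%N by rewrite -ltnS.
  have -> : y j ^+ N = y j ^+ (N - k) * y j ^+ k by rewrite -exprD subnK.
  rewrite w2 (exprNn (_^-1)) exprVn exprMn -exprM.
  by field; rewrite !expf_neq0.
have := sum_bin_even N w; rewrite sum0 mul0rn => /eqP.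
rewrite addr_eq0 => /eqP /(congr1 Num.norm); rewrite normrN !normrX.
move/(pexpIrn N0); rewrite !nnegrE !normr_ge0 => /(_ isT isT) e.
(* Being equidistant from 1 and -1, [w] is imaginary, so [- w ^+ 2] is the square of its modulus. *)
have wc : w^* = - w.
  move/(congr1 (fun x => x ^+ 2)): e; rewrite !normCK rmorphB rmorphD rmorph1 => e.
  have : (w + w^*) *+ 2 = 0.
    have -> : (w + w^*) *+ 2 = (1 + w) * (1 + w^*) - (1 - w) * (1 - w^*) by ring.
    by rewrite e subrr.
  by move/eqP; rewrite mulrn_eq0 /= addrC addr_eq0 => /eqP.
have : (N%:R ^+ 2 * y j)^-1 = `|w| ^+ 2.
  by rewrite normCK wc mulrN -expr2 w2 opprK.
move=> wy; have : 0 <= (N%:R ^+ 2 * y j)^-1 by rewrite wy exprn_ge0.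
by rewrite invr_ge0 pmulr_rge0 // exprn_gt0 // ltr0n.
Qed.

(** Write [p = p(0) + X q] with [q] bounded by [ub] on the unit disk: if [p(0) < 0], then
    [p(1/N) < 0] once [N > ub / - p(0)]. *)
Lemma poly_limit_ge0 n (p : {poly rat}) :
  (forall N, (n < N)%N -> 0 <= p.[N%:R^-1]) -> 0 <= p.[0].
Proof.
move=> pN; rewrite leNgt; apply/negP => p0.
have : root (p - p.[0]%:P) 0 by rewrite /root !hornerE subrr.
case/factor_theorem => q; rewrite subr0 => pq.
have [ub qub] := poly_disk_bound q 1.
have ub0 : 0 <= ub by apply: le_trans (qub 0 _); rewrite ?normr0 ?ler01.
pose N := (n.+1 + Num.bound (ub / - p.[0]))%N.
have N0 : 0 < N%:R :> rat by rewrite ltr0n.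
have bN : ub / - p.[0] < N%:R.
  apply: lt_le_trans (archi_boundP _) _; last by rewrite ler_nat leq_addl.
  by rewrite divr_ge0 // oppr_ge0 ltW.
have := pN N; rewrite leq_addr => /(_ isT).
have -> : p.[N%:R^-1] = p.[0] + q.[N%:R^-1] / N%:R.
  by rewrite -{1}(subrK p.[0]%:P p) pq !hornerE addrC.
apply/negP; rewrite -ltNge addrC -ltrBrDr sub0r ltr_pdivrMr //.
apply: le_lt_trans (ler_norm _) _; apply: le_lt_trans (qub _ _) _.
  rewrite ger0_norm ?invr_ge0 ?ler0n //.
  by rewrite invf_le1 // ler1n.
by rewrite mulrC -ltr_pdivrMr ?oppr_gt0.
Qed.

(** Applied with [v] a power sum or a monomial symmetric function. At points with [e_k = cosE k]
    evaluated at [x], [v] is a polynomial in [x]; it is nonnegative at [1 / N] for [N > n], hence at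
    0. *)
Lemma stable_ge0 n (v : forall s, ('I_s -> algC) -> algC) (t : {mpoly int[n]}) :
    (forall s (y : 'I_s -> algC), (forall j, 0 <= y j) -> 0 <= v s y) ->
    (forall s s' (y : 'I_s -> algC) (y' : 'I_s' -> algC),
      (forall k, (0 < k <= n)%N -> \sum_j y j ^+ k = \sum_j y' j ^+ k) ->
      v s y = v s' y') ->
    (forall y : 'I_n -> algC,
      v n y = mmap intr (fun i : 'I_n => esymf i.+1 y) t) ->
  forall y : 'I_n -> algC,
    (forall k, (k <= n)%N -> esymf k y = (2 * k)`!%:R^-1) -> 0 <= v n y.
Proof.
move=> v_ge0 v_stable vE y ey.
pose p : {poly rat} := mmap intr (fun i : 'I_n => cosE i.+1) t.
have pE x (z : 'I_n -> algC) :
    (forall k, (k <= n)%N -> esymf k z = ratr (cosE k).[x]) ->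
    v n z = ratr p.[x].
  move=> ez; rewrite vE -[p.[x]]/(horner_eval x p) !rmorph_mmap_intr.
  by apply: eq_mmap_intr => i /=; rewrite ez.
rewrite (pE 0) => [|k kn]; last by rewrite ey // cosE0 fmorphV rmorph_nat.
rewrite ler0q; apply: (@poly_limit_ge0 n) => N nN.
have N0 : (0 < N)%N by apply: leq_ltn_trans nN.
have [z z0 ez] := esymf_approximant N0.
have E0 : ratr (cosE 0).[N%:R^-1] = 1 :> algC.
  by rewrite cosE_inv // muln0 bin0 expr0 divr1 rmorph1.
(* [t] computes [v] in [n] variables while [z] has [N] entries; [z'] has [n] entries and the same
   [e_1, ..., e_n]. *)
have [z' [ez' _]] :=
  exists_esymf n (E0 : (fun k => ratr (cosE k).[N%:R^-1]) 0%N = 1).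
rewrite -(ler0q algC) -(pE _ z') // (v_stable _ _ _ z); first exact: v_ge0.
apply: psum_esymf => k kn; rewrite ez' // ez //.
exact: leq_trans (ltnW nN).
Qed.

Lemma msf_ge0 n (l : {ffun 'I_n -> 'I_n.+1}) s (y : 'I_s -> algC) :
  (forall j, 0 <= y j) -> 0 <= msf l y.
Proof.
move=> y0; apply: sumr_ge0 => f _; apply: prodr_ge0 => j _.
exact: exprn_ge0.
Qed.

Variables (n : nat) (y : 'I_n -> algC).
Hypothesis ey : forall k, (k <= n)%N -> esymf k y = (2 * k)`!%:R^-1.

(** This settles the sign in [psum_cos]. *)
Lemma psum_cos_ge0 k : (0 < k <= n)%N -> 0 <= \sum_j y j ^+ k.
Proof.
move=> /[dup] kn /andP[_ /psum_poly_esymf[t tE]].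
pose v s (z : 'I_s -> algC) := \sum_j z j ^+ k.
apply: (@stable_ge0 n v t) => // [s z z0 | s s' z z' eqp | z].
- by apply: sumr_ge0 => j _; apply: exprn_ge0.
- exact: eqp.
- exact: tE.
Qed.

Lemma msf_cos_nat (l : {ffun 'I_n -> 'I_n.+1}) : l \in partitions n ->
  (2 * n)`!%:R * msf l y \is a Num.nat.
Proof.
move=> lP; have [t tE tw] := msf_esymf l.
have ge0 : 0 <= msf l y.
  apply: (@stable_ge0 n (fun s => @msf n s _ l) t) => // [s z|s s' z z' zz'|z].
  - exact: msf_ge0.
  - exact: msf_stable.
  - exact: tE.
rewrite natrEint mulr_ge0 ?ler0n // andbT.
have -> : msf l y = ratr (mmap intr (fun i : 'I_n => (2 * i.+1)`!%:R^-1) t).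
  rewrite tE rmorph_mmap_intr; apply: eq_mmap_intr => i /=.
  by rewrite ey // fmorphV rmorph_nat.
rewrite -(rmorph_nat (@ratr algC)) -rmorphM Cint_rat.
exact: mmap_inv_fact_int.
Qed.

End Positivity.

(** * Bernoulli numbers and the cosine *)

Section BernoulliSeries.
Implicit Types (N : nat) (c : rat).

Lemma scaleXM c (p q : {poly rat}) : scaleX c (p * q) = scaleX c p * scaleX c q.
Proof.
apply/polyP => i; rewrite coef_scaleX !coefM mulr_sumr.
apply: eq_bigr => j _; rewrite !coef_scaleX.
have /subnKC {1}<- : (j <= i)%N by rewrite -ltnS.
by rewrite exprD; ring.
Qed.

Lemma scaleXD c (p q : {poly rat}) : scaleX c (p + q) = scaleX c p + scaleX c q.
Proof. by apply/polyP => i; rewrite coefD !coef_scaleX coefD mulrDr. Qed.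

Lemma scaleXN c (p : {poly rat}) : scaleX c (- p) = - scaleX c p.
Proof. by apply/polyP => i; rewrite coefN !coef_scaleX coefN mulrN. Qed.

Lemma scaleX1 c : scaleX c 1 = 1.
Proof.
by apply/polyP => i; rewrite coef_scaleX coef1; case: i => [|i]; rewrite ?mulr0 ?mulr1.
Qed.

Lemma scaleXX c : scaleX c 'X = c *: 'X.
Proof.
apply/polyP => i; rewrite coef_scaleX coefZ coefX.
by case: eqP => [->|_]; rewrite ?mulr0.
Qed.

Lemma eqmX_scaleX N c (p q : {poly rat}) :
  eqmX N p q -> eqmX N (scaleX c p) (scaleX c q).
Proof. by move=> pq i iN; rewrite !coef_scaleX pq. Qed.

Definition expX N c : {poly rat} := \poly_(i < N) (c ^+ i / i`!%:R).

Lemma fact_neq0 m : m`!%:R != 0 :> rat.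
Proof. by rewrite pnatr_eq0 -lt0n fact_gt0. Qed.

Lemma inv_fact_bin i j : (j <= i)%N ->
  (j`!%:R)^-1 / (i - j)`!%:R = 'C(i, j)%:R / i`!%:R :> rat.
Proof.
move=> ji; rewrite -(bin_fact ji) !natrM.
have := fact_neq0 j; have := fact_neq0 (i - j).
have : 'C(i, j)%:R != 0 :> rat by rewrite pnatr_eq0 -lt0n bin_gt0.
by move=> b0 u0 v0; field; rewrite b0 u0 v0.
Qed.

Lemma expXD N a b : eqmX N (expX N a * expX N b) (expX N (a + b)).
Proof.
move=> i iN; rewrite coefM coef_poly iN addrC exprDn mulr_suml.
apply: eq_bigr => j _; have ji : (j <= i)%N by rewrite -ltnS.
rewrite !coef_poly (leq_ltn_trans ji iN) (leq_ltn_trans (leq_subr _ _) iN).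
rewrite mulrACA inv_fact_bin //= -mulr_natr.
by ring.
Qed.

Lemma scaleX_expX N c a : scaleX c (expX N a) = expX N (c * a).
Proof.
apply/polyP => i; rewrite coef_scaleX !coef_poly; case: ifP; rewrite ?mulr0 //.
by rewrite mulrA exprMn.
Qed.

Definition bernX N : {poly rat} := \poly_(i < N) (bernoulli i / i`!%:R).

(** [bernX] truncates [t / (e^t - 1)]; coefficientwise, the identity is the recurrence
    [bernoulli_rec]. *)
Lemma bernX_expX N : eqmX N (bernX N * (expX N 1 - 1)) 'X.
Proof.
move=> [|m] mN; rewrite coefM coefX.
  by rewrite big_ord1 coefB coef1 !coef_poly mN expr0 divr1 subrr mulr0.
rewrite big_ord_recr /= subnn coefB coef1 [(expX _ _)`_0]coef_poly.
rewrite (leq_ltn_trans _ mN) // expr0 divr1 subrr mulr0 addr0.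
transitivity (m.+1`!%:R^-1 * \sum_(j < m.+1) 'C(m.+1, j)%:R * bernoulli j).
  rewrite mulr_sumr; apply: eq_bigr => j _.
  have jm : (j <= m.+1)%N by apply: ltnW.
  rewrite coefB coef1 !coef_poly gtn_eqF ?subn_gt0 ?ltn_ord // subr0.
  rewrite (leq_ltn_trans jm mN) (leq_ltn_trans (leq_subr _ _) mN) expr1n mul1r.
  by rewrite -mulrA inv_fact_bin //; ring.
by rewrite bernoulli_rec; case: m mN => [|m] _; rewrite ?mulr0 // mulr1.
Qed.

(** As [q] has order exactly 1, dividing by it costs one order of precision. *)
Lemma eqmX_cancel N (p q : {poly rat}) : q`_0 = 0 -> q`_1 != 0 ->
  eqmX N.+1 (p * q) 0 -> eqmX N p 0.
Proof.
move=> q0 q1 pq; elim/ltn_ind => i IH iN.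
have := pq i.+1 iN; rewrite coefM !big_ord_recr /= subnn q0 mulr0 addr0.
rewrite subSnn big1 => [|j _]; last first.
  by rewrite (IH j) ?coef0 ?mul0r // (ltn_trans _ iN) /=.
by rewrite add0r !coef0 => /eqP; rewrite mulf_eq0 (negPf q1) orbF => /eqP.
Qed.

(* [tanhX N] is the expansion of t tanh t, from
   tanh t = 1 - 2 / (e^(2t) + 1) and
   1 / (u + 1) = 1 / (u - 1) - 2 / (u^2 - 1). *)
Definition tanhX N := 'X - scaleX 2 (bernX N) + scaleX 4 (bernX N).

Lemma tanhX_expX N :
  eqmX N (tanhX N.+1 * (expX N.+1 2 + 1)) ('X * (expX N.+1 2 - 1)).
Proof.
set e := expX N.+1 2; set T := tanhX _.
pose b2 := scaleX 2 (bernX N.+1); pose b4 := scaleX 4 (bernX N.+1).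
have B2 : eqmX N.+1 (b2 * (e - 1)) (2 *: 'X).
  have := eqmX_scaleX 2 (@bernX_expX N.+1).
  by rewrite scaleXM scaleXD scaleXN scaleX1 scaleX_expX scaleXX mulr1.
have B4 : eqmX N.+1 (b4 * (e * e - 1)) (4 *: 'X).
  have := eqmX_scaleX 4 (@bernX_expX N.+1).
  rewrite scaleXM scaleXD scaleXN scaleX1 scaleX_expX scaleXX mulr1.
  apply: eqmX_trans; apply: eqmXM => //; apply: eqmXB => //.
  by have := @expXD N.+1 2 2.
have e0 : e`_0 = 1 by rewrite coef_poly expr0 divr1.
suff H : eqmX N (T * (e + 1) - 'X * (e - 1)) 0.
  by move=> i /H; rewrite coefB coef0 => /eqP; rewrite subr_eq0 => /eqP.
case: N => [//|N] in e T b2 b4 B2 B4 e0 *.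
(* Multiplying by [e - 1] allows [B2] and [B4] to replace the Bernoulli series by monomials. *)
apply: (@eqmX_cancel N.+1 _ (e - 1)).
- by rewrite coefB coef1 e0 subrr.
- by rewrite coefB coef1 coef_poly.
have -> : (T * (e + 1) - 'X * (e - 1)) * (e - 1) =
    b4 * (e * e - 1) - b2 * (e - 1) * (e + 1) + 2 *: 'X * (e - 1).
  by rewrite /T /tanhX -/b2 -/b4 -!mul_polyC; ring.
have -> : 0 = 4 *: 'X - 2 *: 'X * (e + 1) + 2 *: 'X * (e - 1) :> {poly rat}.
  by rewrite -!mul_polyC; ring.
by apply: eqmXD => //; apply: eqmXB => //; apply: eqmXM.
Qed.

(** [T] is symmetrised so that its odd coefficients vanish by construction; [T1] and [T2] arise on
    multiplying by [e^(-t)] and [e^t]. *)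
Lemma tanhX_even N (T := tanhX N.+1) :
  eqmX N ((T + scaleX (-1) T) * (expX N.+1 1 + expX N.+1 (-1)))
         (2 *: 'X * (expX N.+1 1 - expX N.+1 (-1))).
Proof.
have TE : eqmX N (T * (expX N.+1 2 + 1)) ('X * (expX N.+1 2 - 1)).
  exact: tanhX_expX.
clearbody T.
pose e k := expX N.+1 k.
have eD a b : eqmX N (e a * e b) (e (a + b)).
  exact: eqmX_leq (leqnSn N) (@expXD _ _ _).
have := eqmX_scaleX (-1) TE.
rewrite !scaleXM !scaleXD scaleXN !scaleX1 !scaleX_expX scaleXX.
set T' := scaleX (-1) T => TE'.
have T1 : eqmX N (T * (e 1 + e (-1))) ('X * (e 1 - e (-1))).
  have H : eqmX N (T * (e 2 + 1) * e (-1)) ('X * (e 2 - 1) * e (-1)).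
    exact: eqmXM.
  have E1 : eqmX N (e 2 * e (-1)) (e 1) by apply: eD.
  apply: eqmX_trans (eqmX_trans _ H) _.
    by rewrite -mulrA; apply: eqmXM => //; rewrite mulrDl mul1r;
      apply: eqmXD => //; apply: eqmX_sym.
  by rewrite -mulrA; apply: eqmXM => //; rewrite mulrBl mul1r; apply: eqmXB.
have T2 : eqmX N (T' * (e 1 + e (-1))) ('X * (e 1 - e (-1))).
  have H : eqmX N (T' * (e (-1 * 2) + 1) * e 1) (-1 *: 'X * (e (-1 * 2) - 1) * e 1).
    exact: eqmXM.
  have E1 : eqmX N (e (-1 * 2) * e 1) (e (-1)) by apply: eD.
  apply: eqmX_trans (eqmX_trans _ H) _.
    rewrite -mulrA; apply: eqmXM => //; rewrite mulrDl mul1r addrC.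
    by apply: eqmXD => //; apply: eqmX_sym.
  have -> : -1 *: 'X * (e (-1 * 2) - 1) * e 1 = 'X * (e 1 - e (-1 * 2) * e 1).
    by rewrite scaleN1r; ring.
  by apply: eqmXM => //; apply: eqmXB.
rewrite mulrDl scaler_nat mulrnAl mulr2n.
exact: eqmXD.
Qed.

(** Normalised so that [t tanh t = \sum_k 2 tanc k t^(2k)]; the factor in [phi] is then
    [tanc k / k]. *)
Definition tanc k : rat :=
  4 ^+ k * (4 ^+ k - 1) * bernoulli (2 * k) / (2 * (2 * k)`!%:R).

(** Compare coefficients of [t^(2k)] in [(t tanh t) cosh t = t sinh t]. *)
Lemma sum_tanc k : (0 < k)%N ->
  \sum_(i < k.+1) tanc i / (2 * (k - i))`!%:R = k%:R / (2 * k)`!%:R.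
Proof.
move=> k0; have k2 : (2 * k < (2 * k).+1)%N by [].
have := @tanhX_even (2 * k).+1 (2 * k)%N k2.
set T := tanhX _; set N := (2 * k).+2.
have TE i : (i <= k)%N -> (T + scaleX (-1) T)`_(2 * i) = 4 * tanc i.
  move=> ik; rewrite coefD coef_scaleX exprM sqrrN !expr1n mul1r.
  rewrite /T /tanhX coefD coefB !coef_scaleX coefX coef_poly ifT; last first.
    by lia.
  have -> : (2 * i == 1)%N = false by lia.
  rewrite /tanc !exprM.
  have -> : 4 ^+ 2 = 4 * 4 :> rat by [].
  have -> : 2 ^+ 2 = 4 :> rat by [].
  rewrite exprMn; have := fact_neq0 (2 * i) => f0.
  rewrite mulr0n; move: (_`!%:R) f0 => F f0; move: (4 ^+ i) => q; by field.
have TO i : (T + scaleX (-1) T)`_(2 * i).+1 = 0.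
  by rewrite coefD coef_scaleX exprS exprM sqrrN !expr1n mulr1 mulN1r subrr.
have EE i : (i <= k)%N -> (expX N 1 + expX N (-1))`_(2 * i) = 2 / (2 * i)`!%:R.
  move=> ik; have iN : (2 * i < N)%N by rewrite /N; lia.
  rewrite coefD !coef_poly iN expr1n -signr_odd mul2n odd_double expr0.
  by rewrite -mulrDl.
rewrite coefM -scalerAl coefZ coefXM.
have -> : (2 * k == 0)%N = false by lia.
have -> : (2 * k).-1 = (2 * k.-1).+1 by lia.
have kN : ((2 * k.-1).+1 < N)%N by rewrite /N; lia.
have sg m : (-1) ^+ (2 * m).+1 = -1 :> rat.
  by rewrite -signr_odd /= mul2n odd_double expr1.
rewrite coefB !coef_poly kN expr1n sg.
(* Only even indices contribute; 8 is the product of the 4 in [TE] and the 2 in [EE]. *)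
pose f i := (T + scaleX (-1) T)`_i * (expX N 1 + expX N (-1))`_(2 * k - i).
have -> : \sum_(i < (2 * k).+1) (T + scaleX (-1) T)`_i
    * (expX N 1 + expX N (-1))`_(2 * k - i)
    = \sum_(i < k.+1) 8 * (tanc i / (2 * (k - i))`!%:R).
  transitivity (\sum_(i < k.+1) f (2 * i)%N).
    rewrite big_ord_recr -/(f _) (sum_even_odd f) big_ord_recr; congr (_ + _).
    by apply: eq_bigr => i _; rewrite {2}/f TO mul0r addr0.
  apply: eq_bigr => i _; have ik : (i <= k)%N by rewrite -ltnS.
  rewrite /f -mulnBr TE // EE ?leq_subr //.
  by move: (tanc i) (_`!%:R^-1) => u v; ring.
rewrite -mulr_sumr => H.
have n8 : 8 != 0 :> rat by rewrite pnatr_eq0.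
apply: (mulfI n8); rewrite {}H.
have -> : k%:R / (2 * k)`!%:R = (2 * (2 * k.-1).+1`!%:R)^-1 :> rat.
  case: (k) k0 => // j _ /=; have f0 := fact_neq0 (2 * j).+1.
  have j0 : j.+1%:R != 0 :> rat by rewrite pnatr_eq0.
  have -> : (2 * j.+1)`!%:R = 2 * j.+1%:R * (2 * j).+1`!%:R :> rat.
    by rewrite mulnS add2n factS natrM -[2 * _]natrM mulnS.
  move: (j.+1%:R) (_`!%:R) j0 f0 => u v u0 v0.
  by field; rewrite u0 v0.
move: (_`!%:R) (fact_neq0 (2 * k.-1).+1) => v v0.
by field.
Qed.

Definition cosX N : {poly rat} := \poly_(k < N) ((-1) ^+ k / (2 * k)`!%:R).

(** For [G = cos (sqrt x)], [x G' / G = - sqrt x tan (sqrt x) / 2], which is [t tanh t / 2] at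
    [t = i sqrt x]; hence the signs. *)
Lemma dlog_cosX N : dlog N (\poly_(k < N) ((-1) ^+ k * tanc k)) (cosX N).
Proof.
move=> k kN; rewrite coef_XM_deriv coef_poly kN coefM.
transitivity ((-1) ^+ k * \sum_(i < k.+1) tanc i / (2 * (k - i))`!%:R).
  have [->|k0] := posnP k.
    by rewrite big_ord1 /tanc expr0 subrr mulr0 !mul0r mulr0.
  by rewrite sum_tanc // -mulr_natr; ring.
rewrite mulr_sumr; apply: eq_bigr => i _; have ik : (i <= k)%N by rewrite -ltnS.
rewrite !coef_poly (leq_ltn_trans ik kN) (leq_ltn_trans (leq_subr _ _) kN).
by rewrite -{1}(subnKC ik) exprD; ring.
Qed.

End BernoulliSeries.

(** [\prod_j (1 - y_j X)] agrees with [cosX] up to degree [n], so the power sum is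
    [(-1)^(k+1) tanc k]; being nonnegative, it equals the absolute value. *)
Lemma psum_cos n (y : 'I_n -> algC) k :
    (forall k, (k <= n)%N -> esymf k y = (2 * k)`!%:R^-1) ->
  (0 < k <= n)%N -> \sum_j y j ^+ k = ratr `|tanc k|.
Proof.
move=> ey kn; have := psum_cos_ge0 ey kn.
have [k0 kn'] := andP kn.
have eF : eqmX n.+1 (map_poly ratr (cosX n.+1)) (\prod_(j < n) (1 - y j *: 'X)).
  move=> i iN; rewrite coef_prod_linear ey // coef_map coef_poly iN /=.
  by rewrite rmorphM rmorphXn rmorphN1 fmorphV rmorph_nat.
have F0 : (\prod_(j < n) (1 - y j *: 'X))`_0 = 1.
  by rewrite coef_prod_linear esymf0 mulr1.
have := dlog_congr (@eqmX_refl _ _ _) eF (dlog_map (@ratr algC) (@dlog_cosX n.+1)).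
move/(dlog_unique_log (@dlog_prod_linear _ n.+1 _ y))/(_ F0)/(_ k kn').
rewrite coefN coef_psums // (gtn_eqF k0) coef_map coef_poly ltnS kn' /=.
move/eqP; rewrite eqr_oppLR => /eqP -> p0.
by rewrite -(ger0_norm p0) normrN rmorphM rmorphXn rmorphN1 normrMsign ratr_norm.
Qed.

Lemma phi_norm n (l : {ffun 'I_n -> 'I_n.+1}) :
  `|phi l| = (2 * n)`!%:R *
    \prod_(k < n) ((l k)`!%:R^-1 * (`|tanc k.+1| / k.+1%:R) ^+ l k).
Proof.
rewrite /phi normrM normr_nat normr_prod; congr (_ * _).
apply: eq_bigr => k _; rewrite normrM normrV ?unitfE ?fact_neq0 // normr_nat.
congr (_ * _); rewrite normrX; congr (_ ^+ _).
have -> : `|tanc k.+1| / k.+1%:R = `|tanc k.+1 / k.+1%:R|.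
  by rewrite [RHS]normf_div normr_nat.
congr (`| _ |).
have k0 : k.+1%:R != 0 :> rat by rewrite pnatr_eq0.
have f0 := fact_neq0 (2 * k.+1).
rewrite /tanc natrM; move: (_`!%:R) k.+1%:R (4 ^+ _) f0 k0 => f u q f0 u0.
by field; rewrite f0 u0.
Qed.

Theorem theorem5p1 (n : nat) :
  exists c : {ffun 'I_n -> 'I_n.+1} -> nat,
    forall r : nat,
      (2 * n)`!%:R *: A_ n r = \sum_(l in partitions n) (c l)%:R *: h_ l r.
Proof.
have [|y [ey _]] := @exists_esymf algC n (fun k => (2 * k)`!%:R^-1).
  by rewrite muln0 invr1.
(* By [msf_cos_nat] the truncation does not change the value. *)
exists (fun l => Num.truncn ((2 * n)`!%:R * msf l y)) => r.
rewrite scalerA divff ?fact_neq0 // scale1r.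
(* The [y j] lie in [algC], so the identity is proved there and pulled back along an injective
   morphism. *)
pose toC : {rmorphism {mpoly rat[r]} -> {mpoly algC[r]}} := map_mpoly (@ratr algC).
have toC_inj : injective toC.
  move=> p q /mpolyP e; apply/mpolyP => m; apply: (fmorph_inj (ratr : rat -> algC)).
  by have := e m; rewrite !mcoeff_map_mpoly.
apply: toC_inj.
pose h k := toC (complete k r).
pose P := map_poly toC (\poly_(k < n.+1) (if k == 0%N then 0 else powersum k r)).
have h0 : h 0%N = 1 by rewrite /h complete0 rmorph1.
have hP : dlog n.+1 P (\poly_(k < n.+1) h k).
  have := dlog_map toC (@dlog_complete n r).
  apply: dlog_congr => // k kn; rewrite coef_map !coef_poly kn //.
have /(congr1 (fun p => (2 * n)`!%:R *: p)) := cauchy_identity h0 hP y.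
rewrite !scaler_sumr !rmorph_sum => cauchy.
(* [phi_norm] and [psum_cos] match the coefficients of the power sums with the left side of the
   Cauchy identity. *)
transitivity (\sum_(l in partitions n) (2 * n)`!%:R *: \prod_(k < n)
     ((l k)`!%:R^-1 *: (((\sum_j y j ^+ k.+1) / k.+1%:R) *: P`_k.+1) ^+ l k)).
  apply: eq_bigr => l _; rewrite [LHS]map_mpolyZ phi_norm rmorphM rmorph_nat -scalerA.
  congr (_ *: _); rewrite rmorph_prod rmorph_prod -scaler_prod.
  apply: eq_bigr => k _; rewrite rmorphM fmorphV rmorph_nat -scalerA.
  congr (_ *: _); rewrite !rmorphXn exprZn rmorphM fmorphV rmorph_nat.
  rewrite (psum_cos ey) ?ltn_ord //; congr (_ *: _ ^+ _).
  by rewrite coef_map coef_poly ltnS ltn_ord.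
rewrite cauchy; apply: eq_bigr => l lP; rewrite [RHS]map_mpolyZ rmorph_nat.
rewrite truncnK ?msf_cos_nat // scalerA; congr (_ *: _).
by rewrite rmorph_prod; apply: eq_bigr => k _; rewrite rmorphXn.
Qed.
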